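(* Let $T,S\in\mathbb{B}_A(\mathcal{H})$. Then $$\|T+S\|_A\leq \sqrt{\frac{1}{2}\left(\|T\|_A^2+\|S\|_A^2+\sqrt{\left(\|T\|_A^2-\|S\|_A^2\right)^2+4\|TS^{\sharp_A}\|_A^2}\right)+2\omega_A(S^{\sharp_A}T)}\leq \|T\|_A+\|S\|_A.$$
   Context: $\mathcal{H}$ is a complex Hilbert space with inner product $\langle\cdot,\cdot\rangle$, $\mathbb{B}(\mathcal{H})$ is the algebra of bounded linear operators on $\mathcal{H}$, and $A\in\mathbb{B}(\mathcal{H})$ is a fixed nonzero positive operator (i.e. $\langle Ax,x\rangle\geq 0$ for all $x$; $A$ need not be injective or have closed range). Put $\langle x,y\rangle_A=\langle Ax,y\rangle$ and $\|x\|_A=\sqrt{\langle x,x\rangle_A}$. $\mathcal{R}(X)$ denotes the range of $X$, and $T^*$ the usual adjoint. $\mathbb{B}_A(\mathcal{H})=\{T\in\mathbb{B}(\mathcal{H}):\mathcal{R}(T^*A)\subseteq\mathcal{R}(A)\}$ is the set of operators $T$ admitting an $A$-adjoint, i.e. some $S\in\mathbb{B}(\mathcal{H})$ with $AS=T^*A$. For $T\in\mathbb{B}_A(\mathcal{H})$, $T^{\sharp_A}\in\mathbb{B}(\mathcal{H})$ denotes the distinguished $A$-adjoint, the reduced (Douglas) solution of $AX=T^*A$, i.e. the unique solution with $\mathcal{R}(T^{\sharp_A})\subseteq\overline{\mathcal{R}(A)}$. The $A$-seminorm is $\|T\|_A=\sup\{\|Tx\|_A: x\in\overline{\mathcal{R}(A)},\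 \|x\|_A=1\}$; for $T\in\mathbb{B}_A(\mathcal{H})$ it is finite and equals $\sup\{\|Tx\|_A: x\in\mathcal{H},\ \|x\|_A=1\}$. The $A$-numerical radius is $\omega_A(T)=\sup\{|\langle Tx,x\rangle_A|: x\in\mathcal{H},\ \|x\|_A=1\}$. *)

(* Defs.v *)
From mathcomp Require Import all_boot all_order all_algebra.
From mathcomp Require Import complex.
From mathcomp Require Import all_classical all_reals all_analysis.

Set Implicit Arguments.
Unset Strict Implicit.
Unset Printing Implicit Defensive.

Import Order.TTheory GRing.Theory Num.Theory.
Import numFieldNormedType.Exports.

Local Open Scope classical_set_scope.
Local Open Scope ring_scope.
Local Open Scope complex_scope.

(* A complex Hilbert space is a complete normed space [H] over [R[i]] with an
   inner product [ip], linear in its first argument and conjugate-linear in the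
   second one, that induces the norm. *)
Definition induces_norm (R : realType) (H : completeNormedModType R[i])
    (ip : {dot H for Num.conj}) : Prop :=
  forall x : H, `|x| ^+ 2 = ip x x.

(* Norms take their values in [R[i]] (on its real half-line), hence so does
   [M], which is necessarily real as soon as [H] is nonzero. *)
Definition bounded_op (R : realType) (H : completeNormedModType R[i])
    (T : H -> H) : Prop :=
  linear T /\ exists M : R[i], forall x, `|T x| <= M * `|x|.

Section Operators.
Context (R : realType) (H : completeNormedModType R[i]).
Context (ip : {dot H for Num.conj}).
Implicit Types (A T S X : H -> H) (x : H).

(* On [R[i]], [0 <= z] means that [z] is real and nonnegative. *)
Definition positive_op A : Prop := forall x, 0 <= ip (A x) x.

(* [get] picks the element of the set, which exists for bounded [T] (Riesz)
   and is unique. *)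
Definition adjoint T : H -> H :=
  get [set X | bounded_op X /\ forall x y, ip (T x) y = ip x (X y)].

Definition BA A : set (H -> H) :=
  [set T | bounded_op T /\ range (adjoint T \o A) `<=` range A].

(* For positive [A] and [T] in [BA A], [get] picks the unique element of the
   set, which is nonempty by Douglas' theorem. *)
Definition sharp A T : H -> H :=
  get [set X | [/\ bounded_op X, A \o X = adjoint T \o A
                 & range X `<=` closure (range A)]].

Definition seminormA A x : R := Num.sqrt (complex.Re (ip (A x) x)).

(* [sup] is the real supremum; the sets below are nonempty and bounded above
   when [A] is positive and nonzero and [T] is in [BA A]. *)
Definition opnormA A T : R :=
  sup [set seminormA A (T x) | x in
         [set x | closure (range A) x /\ seminormA A x = 1]].

Definition numradA A T : R :=
  sup [set complex.Re `|ip (A (T x)) x| | x in [set x | seminormA A x = 1]].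

End Operators.

(* Main.v *)
Require Import Defs.
From mathcomp Require Import all_boot all_order all_algebra.
From mathcomp Require Import complex.
From mathcomp Require Import all_classical all_reals all_analysis.
From mathcomp Require Import ring lra.
Import Order.TTheory GRing.Theory Num.Theory.
Import numFieldNormedType.Exports.
Local Open Scope classical_set_scope.
Local Open Scope ring_scope.
Local Open Scope complex_scope.

Set Implicit Arguments.
Unset Strict Implicit.
Unset Printing Implicit Defensive.

(** Write [|x|_A] for the seminorm of the positive semi-definite form
    [<x, y>_A = <A x, y>], and [T#] for the distinguished [A]-adjoint, so that
    [<T x, y>_A = <x, T# y>_A].

    Let [|x|_A = 1], [u = T x], [v = S x] and [q = |u|_A^2 + |v|_A^2]. Then
    [|u + v|_A^2 = q + 2 Re <u, v>_A], and the cross term is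
    [Re <S# T x, x>_A <= omega_A(S# T)]. For the other term put
    [y = T# u + S# v]. Then [q = <x, y>_A <= |y|_A], whereas
    [|y|_A^2 <= |T|^2 |u|^2 + |S|^2 |v|^2 + 2 |T S#| |u| |v|], because
    [<T# u, S# v>_A = <u, T S# v>_A]. The right-hand side is a quadratic form in
    [(|u|, |v|)] whose largest eigenvalue [lam] is exactly the first summand
    under the outer square root of the theorem. Hence [q^2 <= lam q], that is
    [q <= lam] ([sum_sqr_snorm_le]). The second inequality of the theorem
    follows from [|T S#| <= |T| |S|] and [omega_A(S# T) <= |T| |S|].

    What gives these inequalities a meaning is that the objects in them exist
    and that the suprema are finite.
    - The adjoint exists by the Riesz representation theorem, which rests on
      orthogonal projections ([orthogonal_projection], [adjointP]).
    - [T#] is found by projecting a solution of [A u = T^* A y] onto the closure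
      of the range of [A]. It is bounded by the uniform boundedness principle,
      applied to the functionals [y |-> <T# y, A z> = <T^* A y, z>], which are
      bounded one by one ([uniform_boundedness], [sharpP]).
    - [T] is bounded for the [A]-seminorm. Indeed [B = T# T] is self-adjoint for
      the form, so iterating Cauchy-Schwarz bounds [|B x|_A] by
      [|B^(2^n) x|_A^(1/2^n)] when [|x|_A = 1], and the operator norm of [B]
      controls the limit ([selfadjoint_snorm_le], [BA_A_bounded]).
    - Since [x] and its projection onto the closure of the range of [A] have the
      same image under [A], a supremum over that closure bounds [|X x|_A] for
      every [x] ([opnormA_A_bounded]). *)

Local Notation normc := Normc.normc.
Local Notation Re := complex.Re.

(** * The modulus of a complex number *)

Section ComplexModulus.
Context {R : realType}.
Implicit Types (z : R[i]) (t : R).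

Lemma normc_ge0 z : 0 <= normc z.
Proof. by case: z => a b; apply: sqrtr_ge0. Qed.

Lemma Re_le_normc z : Re z <= normc z.
Proof.
have := normc_ge_Re z; rewrite normc_def lecR => h.
by apply: le_trans (ler_norm _) _; case: z h.
Qed.

Lemma normcJ z : normc (conjc z) = normc z.
Proof. by case: z => a b /=; rewrite sqrrN. Qed.

Lemma normcR t : normc t%:C = `|t|.
Proof. by rewrite /= expr0n addr0 sqrtr_sqr. Qed.

Lemma conjcR t : conjc t%:C = t%:C.
Proof. exact: conjc_real. Qed.

Lemma ReD z w : Re (z + w) = Re z + Re w.
Proof. by case: z; case: w. Qed.

Lemma ReRM t z : Re (t%:C * z) = t * Re z.
Proof. by case: z => a b /=; rewrite mul0r subr0. Qed.

Lemma mulJc z : conjc z * z = (normc z ^+ 2)%:C.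
Proof. by rewrite mulrC -sqr_normc rmorphXn. Qed.

End ComplexModulus.

(** * Positive semi-definite Hermitian forms *)

Section SemiInnerProduct.
Context (R : realType) (V : lmodType R[i]).
Implicit Types (x y z : V).

(** The form is allowed to be degenerate so that one theory serves both the inner
    product and the form [<A x, y>]. *)
Record semi_dot (f : V -> V -> R[i]) : Prop := SemiDot {
  sdot_lin : forall a x y z, f (a *: x + y) z = a * f x z + f y z;
  sdot_conj : forall x y, f y x = conjc (f x y);
  sdot_ge0 : forall x, 0 <= f x x }.

Definition snorm (f : V -> V -> R[i]) x : R := Num.sqrt (Re (f x x)).

Context (f : V -> V -> R[i]) (sd : semi_dot f).
Local Notation N := (snorm f).

Lemma sdotDl x y z : f (x + y) z = f x z + f y z.
Proof. by rewrite -{1}[x]scale1r (sdot_lin sd) mul1r. Qed.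

Lemma sdot0l z : f 0 z = 0.
Proof. by apply: (@addrI _ (f 0 z)); rewrite -sdotDl !addr0. Qed.

Lemma sdotZl a x z : f (a *: x) z = a * f x z.
Proof. by rewrite -{1}[a *: x]addr0 (sdot_lin sd) sdot0l addr0. Qed.

Lemma sdotBl x y z : f (x - y) z = f x z - f y z.
Proof. by rewrite sdotDl -scaleN1r sdotZl mulN1r. Qed.

Lemma sdotDr x y z : f z (x + y) = f z x + f z y.
Proof. by rewrite !(sdot_conj sd _ z) sdotDl rmorphD. Qed.

Lemma sdotZr a x z : f z (a *: x) = conjc a * f z x.
Proof. by rewrite !(sdot_conj sd _ z) sdotZl rmorphM. Qed.

Lemma sdotBr x y z : f z (x - y) = f z x - f z y.
Proof. by rewrite !(sdot_conj sd _ z) sdotBl rmorphB. Qed.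

Lemma normc_sdotC x y : normc (f x y) = normc (f y x).
Proof. by rewrite (sdot_conj sd y) normcJ. Qed.

Lemma Re_sdotC x y : Re (f x y) = Re (f y x).
Proof. by rewrite (sdot_conj sd y); case: (f y x). Qed.

Lemma snorm_ge0 x : 0 <= N x.
Proof. exact: sqrtr_ge0. Qed.
#[local] Hint Resolve snorm_ge0 : core.

Lemma Re_sdot_ge0 x : 0 <= Re (f x x).
Proof. by have := sdot_ge0 sd x; rewrite lecE => /andP[]. Qed.

Lemma snorm_sqr x : N x ^+ 2 = Re (f x x).
Proof. by rewrite sqr_sqrtr // Re_sdot_ge0. Qed.

Lemma sdotxx x : f x x = (N x ^+ 2)%:C.
Proof.
rewrite snorm_sqr [LHS]complexE (ger0_Im (sdot_ge0 sd x)).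
by rewrite rmorph0 mulr0 addr0.
Qed.

Lemma snormZ a x : N (a *: x) = normc a * N x.
Proof.
rewrite /snorm sdotZl sdotZr mulrA [a * _]mulrC mulJc ReRM.
by rewrite sqrtrM ?sqr_ge0 // sqrtr_sqr ger0_norm // normc_ge0.
Qed.

Lemma snormN x : N (- x) = N x.
Proof. by rewrite -scaleN1r snormZ normcN Normc.normc1 mul1r. Qed.

Lemma snormBC x y : N (x - y) = N (y - x).
Proof. by rewrite -snormN opprB. Qed.

Lemma snormD_sqr x y :
  N (x + y) ^+ 2 = N x ^+ 2 + 2 * Re (f x y) + N y ^+ 2.
Proof.
rewrite !snorm_sqr sdotDl !sdotDr !ReD (Re_sdotC y); ring.
Qed.

Lemma snormB_sqr x y :
  N (x - y) ^+ 2 = N x ^+ 2 - 2 * Re (f x y) + N y ^+ 2.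
Proof.
rewrite snormD_sqr snormN -[- y]sub0r sdotBr (sdot_conj sd 0) sdot0l conjc0.
by rewrite sub0r; case: (f x y) => a b /=; rewrite mulrN.
Qed.

Lemma parallelogram x y :
  N (x + y) ^+ 2 + N (x - y) ^+ 2 = 2 * (N x ^+ 2 + N y ^+ 2).
Proof. rewrite snormD_sqr snormB_sqr; ring. Qed.

(** Both [N x = 0] and [N y = 0] may hold for nonzero vectors; taking a
    large multiple of such a null vector in [key] forces [Re (f x y) <= 0]. *)
Lemma Re_sdot_le x y : Re (f x y) <= N x * N y.
Proof.
(* This is the positivity of the form at [s x - t y]. *)
have key (s t : R) : 2 * (s * t) * Re (f x y) <= (s * N x) ^+ 2 + (t * N y) ^+ 2.
  have := sqr_ge0 (N (s%:C *: x - t%:C *: y)).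
  rewrite snormB_sqr !snormZ !normcR sdotZl sdotZr conjcR !ReRM !exprMn.
  rewrite !real_normK ?num_real //; lra.
have [Nx0|Nx0] := eqVneq (N x) 0; last first.
  have [Ny0|Ny0] := eqVneq (N y) 0; last first.
    have xy0 : 0 < N x * N y by rewrite mulr_gt0 // lt0r ?Nx0 ?Ny0 snorm_ge0.
    rewrite -(ler_pM2l xy0); have := key (N y) (N x); lra.
  rewrite Ny0 mulr0 leNgt; apply/negP => h.
  have := key 1 ((N x ^+ 2 + 1) / Re (f x y)).
  rewrite Ny0 mulr0 expr0n addr0 !mul1r -mulrA divfK ?gt_eqF //.
  have := sqr_ge0 (N x); lra.
rewrite Nx0 mul0r leNgt; apply/negP => h.
have := key ((N y ^+ 2 + 1) / Re (f x y)) 1.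
rewrite Nx0 mulr0 expr0n add0r mulr1 mul1r -mulrA divfK ?gt_eqF //.
have := sqr_ge0 (N y); lra.
Qed.

(** The bound on real parts gives the modulus once [x] is multiplied by the
    conjugate of [f x y], which turns the form into a nonnegative real. *)
Lemma sdot_CauchySchwarz x y : normc (f x y) <= N x * N y.
Proof.
have [->|z0] := eqVneq (normc (f x y)) 0; first exact: mulr_ge0.
have zgt : 0 < normc (f x y) by rewrite lt0r z0 normc_ge0.
rewrite -(ler_pM2l zgt).
have := Re_sdot_le (conjc (f x y) *: x) y.
by rewrite sdotZl mulJc snormZ normcJ mulrA /= expr2.
Qed.

Lemma snormD x y : N (x + y) <= N x + N y.
Proof.
rewrite -ler_sqr ?nnegrE ?addr_ge0 // snormD_sqr.
have := Re_sdot_le x y; nra.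
Qed.

Lemma snorm_tri y x z : N (x - z) <= N (x - y) + N (y - z).
Proof. by have := snormD (x - y) (y - z); rewrite addrA subrK. Qed.

End SemiInnerProduct.
#[local] Hint Resolve snorm_ge0 : core.

(** * The norm, limits and closures in a Hilbert space *)

Section HilbertSpace.
Context (R : realType) (H : completeNormedModType R[i]).
Context (ip : {dot H for Num.conj}) (ipN : induces_norm ip).
Implicit Types (x y z : H) (T A : H -> H).
Local Notation N := (snorm ip).

Lemma ip_semi_dot : semi_dot ip.
Proof.
split.
- by move=> a x y z; rewrite linearDl linearZl_LR.
- by move=> x y; rewrite hermC expr0 mul1r.
- by move=> x; rewrite -ipN exprn_ge0.
Qed.
#[local] Hint Resolve ip_semi_dot : core.

Lemma norm_snorm x : `|x| = (N x)%:C.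
Proof.
apply/eqP; rewrite -(@eqrXn2 _ 2) ?ler0c ?snorm_ge0 //.
by rewrite ipN sdotxx // rmorphXn.
Qed.

Lemma snorm_eq0 x : N x = 0 -> x = 0.
Proof. by move=> x0; apply/eqP; rewrite -normr_eq0 norm_snorm x0. Qed.

Lemma sdot_inj x y : (forall z, ip z x = ip z y) -> x = y.
Proof.
move=> xy; apply/eqP; rewrite -subr_eq0; apply/eqP/snorm_eq0/eqP.
by rewrite -sqrf_eq0 snorm_sqr // sdotBr // xy subrr.
Qed.

Lemma bounded_opP T : bounded_op T ->
  exists2 M : R, 0 <= M & forall x, N (T x) <= M * N x.
Proof.
move=> [_ [M MT]]; exists (normc M) => [|x]; first exact: normc_ge0.
have := MT x; rewrite !norm_snorm => h.
have h0 : 0 <= M * (N x)%:C by apply: le_trans h; rewrite ler0c snorm_ge0.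
rewrite -lecR; apply: (le_trans h); rewrite -(ger0_norm h0) normrM rmorphM.
by rewrite (ger0_norm (_ : 0 <= (N x)%:C)) ?ler0c ?snorm_ge0.
Qed.

Lemma bounded_op_intro T (M : R) : linear T ->
  (forall x, N (T x) <= M * N x) -> bounded_op T.
Proof.
move=> lT MT; split=> //; exists M%:C => x.
by rewrite !norm_snorm -rmorphM lecR.
Qed.

Lemma closureP (E : set H) x :
  closure E x <-> forall e : R, 0 < e -> exists2 y, E y & N (x - y) < e.
Proof.
split=> [Ex e e0|Ex B /nbhs_ballP[e /= e0 xeB]].
  have /Ex[y [Ey]] : nbhs x (ball x e%:C) by apply: nbhsx_ballx; rewrite ltcR.
  by rewrite -ball_normE /= norm_snorm ltcR; exists y.
have eE : e = (Re e)%:C by rewrite RRe_real // gtr0_real.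
have [|y Ey xy] := Ex (Re e); first by rewrite -ltcR -eE.
exists y; split=> //; apply: xeB.
by rewrite -ball_normE /= norm_snorm eE ltcR.
Qed.

(** Completeness in the form used twice below, for minimising sequences and for
    the centres of shrinking balls. *)
Lemma nested_balls_limit (u : nat -> H) (r : nat -> R) :
  (forall m n, (n <= m)%N -> N (u n - u m) <= r n) ->
  (forall e, 0 < e -> exists n, r n < e) ->
  exists l, forall n, N (u n - l) <= r n.
Proof.
move=> ur r0.
have cu : cvg (u @ \oo).
  apply: cauchy_cvg; apply/cauchyP => e e0.
  have eE : e = (Re e)%:C by rewrite RRe_real // gtr0_real.
  have [|n rn] := r0 (Re e); first by rewrite -ltcR -eE.
  exists (u n); exists n => // m /= nm.
  rewrite -ball_normE /= norm_snorm eE ltcR.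
  exact: le_lt_trans (ur _ _ nm) rn.
exists (lim (u @ \oo)) => n.
apply/ler_addgt0Pr => e e0.
have /cvgrPdist_lt/(_ e%:C) := cu.
rewrite ltcR => /(_ e0)[k _ /(_ (maxn n k))] /=.
rewrite leq_maxr => /(_ isT); rewrite norm_snorm ltcR => le.
rewrite (le_trans (snorm_tri ip_semi_dot (u (maxn n k)) _ _)) //.
rewrite lerD ?ur ?leq_maxl //.
by rewrite snormBC // ltW.
Qed.

End HilbertSpace.

(** * Orthogonal projection *)

Lemma lt_inv_nat (R : realType) (e : R) : 0 < e -> exists n, n.+1%:R^-1 < e.
Proof. by move=> /ltr_add_invr[n]; rewrite add0r; exists n. Qed.

(** Replaces passing to the limit in estimates that hold up to a multiple of
    [1 / (n + 1)]. *)
Lemma le0_inv_nat (R : realType) (c K : R) :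
  (forall n, c <= K * n.+1%:R^-1) -> c <= 0.
Proof.
move=> cK; rewrite leNgt; apply/negP => c0.
have [K0|K0] := leP K 0.
  have := cK 0%N; rewrite invr1; lra.
have [n] := lt_inv_nat (divr_gt0 c0 K0).
by rewrite ltr_pdivlMr // mulrC ltNge cK.
Qed.

Section Riesz.
Context (R : realType) (H : completeNormedModType R[i]).
Context (ip : {dot H for Num.conj}) (ipN : induces_norm ip).
Implicit Types (x y z : H) (T A : H -> H) (E : set H).
Local Notation N := (snorm ip).
Let sd : semi_dot ip := ip_semi_dot ipN.

Definition is_subspace E :=
  E 0 /\ forall (a : R[i]) x y, E x -> E y -> E (a *: x + y).

(** A sequence in [E] that minimises the distance to [x] is Cauchy by the
    parallelogram identity. Its limit is the projection, since a nonzero inner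
    product of [x - p] with some [y] in [E] would allow a shorter distance. *)
Lemma orthogonal_projection E x : is_subspace E ->
  exists2 p, closure E p & forall y, E y -> ip (x - p) y = 0.
Proof.
move=> [E0 El].
pose D := [set N (x - y) ^+ 2 | y in E]; pose d := inf D.
have D_lb : has_lbound D by exists 0 => _ [y _ <-]; exact: sqr_ge0.
have hD : has_inf D by split; [exists (N (x - 0) ^+ 2), 0|].
have dle y : E y -> d <= N (x - y) ^+ 2 by move=> Ey; apply: ge_inf => //; exists y.
pose eps n : R := n.+1%:R^-1.
have eps0 n : 0 < eps n by rewrite invr_gt0 ltr0n.
have hu n : exists y, E y /\ N (x - y) ^+ 2 < d + eps n ^+ 2.
  have [|_ [y Ey <-] ylt] := @inf_adherent _ D (eps n ^+ 2) _ hD.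
    by rewrite exprn_gt0.
  by exists y.
have [u uP] := choice hu.
(* The midpoint of [u n] and [u m] is in [E], so its distance to [x] is at least
   [sqrt d]; the parallelogram identity leaves little room for [u n - u m]. *)
have uc m n : (n <= m)%N -> N (u n - u m) <= 2 * eps n.
  move=> nm; have [En ln] := uP n; have [Em lm] := uP m.
  have emn : eps m <= eps n by rewrite lef_pV2 ?posrE ?ltr0n // ler_nat.
  have := parallelogram sd (x - u n) (x - u m).
  have -> : x - u n + (x - u m)
      = (2 : R)%:C *: (x - (2^-1 *: u n + (2^-1 *: u m + 0))).
    rewrite addr0 scalerBr scalerDr !scalerA.
    rewrite rmorph_nat divff ?pnatr_eq0 // !scale1r scaler_nat mulr2n.
    by rewrite opprD addrACA.
  have -> : x - u n - (x - u m) = u m - u n by rewrite opprB addrC addrA subrK.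
  have := dle _ (El 2^-1 _ _ En (El 2^-1 _ _ Em E0)).
  rewrite snormZ // normcR ger0_norm // exprMn (snormBC sd (u m)) => dmid par.
  have em2 : eps m ^+ 2 <= eps n ^+ 2.
    by rewrite ler_sqr ?nnegrE ?(ltW (eps0 _)).
  rewrite -ler_sqr ?nnegrE ?snorm_ge0 //; last first.
    by rewrite mulr_ge0 // ltW.
  rewrite exprMn; lra.
have [p pP] : exists p, forall n, N (u n - p) <= 2 * eps n.
  apply: (nested_balls_limit ipN uc) => e e0.
  by have [n ne] := lt_inv_nat (divr_gt0 e0 (ltr0n R 2)); exists n; rewrite mulrC -ltr_pdivlMr.
exists p => [|y Ey].
  apply/(closureP ipN) => e e0.
  have [n ne] := lt_inv_nat (divr_gt0 e0 (ltr0n R 2)).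
  exists (u n); first by case: (uP n).
  by rewrite snormBC // (le_lt_trans (pP n)) // mulrC -ltr_pdivlMr.
(* The approximate minimality of [u n] is tested against the step [eps n] in the
   direction [z]; the error terms are then of order [eps n]. *)
have Re_le0 z : E z -> Re (ip (x - p) z) <= 0.
  move=> Ez; apply: (@le0_inv_nat _ _ ((1 + N z ^+ 2) / 2 + 2 * N z)) => n.
  have [En ln] := uP n.
  have := dle _ (El (eps n)%:C _ _ Ez En).
  rewrite opprD addrCA addrC snormB_sqr // snormZ // normcR sdotZr // conjcR ReRM.
  rewrite (gtr0_norm (eps0 n)) => dn.
  have -> : x - p = (x - u n) + (u n - p) by rewrite addrA subrK.
  rewrite sdotDl // ReD.
  have le1 : Re (ip (u n - p) z) <= 2 * eps n * N z.
    apply: le_trans (Re_sdot_le sd _ _) _.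
    by rewrite ler_wpM2r ?snorm_ge0.
  have : 2 * Re (ip (x - u n) z) <= eps n * (1 + N z ^+ 2).
    rewrite -(ler_pM2l (eps0 n)); lra.
  rewrite -/(eps n); lra.
(* With [z = c y] the inner product is the real number [|c|^2]. *)
set c := ip (x - p) y.
have : Re (ip (x - p) (c *: y)) <= 0.
  by apply: Re_le0; rewrite -[_ *: _]addr0; apply: El.
rewrite sdotZr // mulJc /= => h.
by apply: Normc.eq0_normc; apply/eqP; rewrite -sqrf_eq0 eq_le h sqr_ge0.
Qed.

End Riesz.

(** * Riesz representation and adjoints *)

Section Operators.
Context (R : realType) (H : completeNormedModType R[i]).
Context (ip : {dot H for Num.conj}) (ipN : induces_norm ip).
Implicit Types (x y z : H) (T A : H -> H) (E : set H).
Local Notation N := (snorm ip).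
Let sd : semi_dot ip := ip_semi_dot ipN.

Lemma linear_opB T x y : linear T -> T (x - y) = T x - T y.
Proof. by move=> lT; rewrite addrC -scaleN1r lT scaleN1r addrC. Qed.

Lemma linear_op0 T : linear T -> T 0 = 0.
Proof. by move=> lT; rewrite -{1}(subrr 0) linear_opB // subrr. Qed.

Lemma linear_opZ T a x : linear T -> T (a *: x) = a *: T x.
Proof. by move=> lT; rewrite -[a *: x]addr0 lT linear_op0 // addr0. Qed.

Lemma linear_opD T x y : linear T -> T (x + y) = T x + T y.
Proof. by move=> lT; rewrite -[x]scale1r lT !scale1r. Qed.

(** A bounded form is continuous, so it vanishes on the closure of any set on which
    it vanishes. *)
Lemma linear_form_closed (phi : H -> R[i]) (M : R) E p :
  (forall a x y, phi (a *: x + y) = a * phi x + phi y) -> 0 <= M ->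
  (forall x, normc (phi x) <= M * N x) ->
  (forall y, E y -> phi y = 0) -> closure E p -> phi p = 0.
Proof.
move=> lphi M0 phiM phi0 /(closureP ipN) Ep.
apply: Normc.eq0_normc; apply/eqP; rewrite eq_le normc_ge0 andbT.
apply: (@le0_inv_nat _ _ M) => n.
have [|y Ey py] := Ep n.+1%:R^-1; first by rewrite invr_gt0 ltr0n.
have -> : phi p = phi (p - y).
  by rewrite addrC -scaleN1r lphi (phi0 y Ey) mulr0 add0r.
by apply: (le_trans (phiM _)); rewrite ler_wpM2l // ltW.
Qed.

(** The representing vector is a multiple of any nonzero [w] orthogonal to the
    kernel, because [x - (phi x / phi w) w] is always in the kernel. *)
Lemma riesz_representation (phi : H -> R[i]) (M : R) :
  (forall a x y, phi (a *: x + y) = a * phi x + phi y) -> 0 <= M ->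
  (forall x, normc (phi x) <= M * N x) ->
  exists z, forall x, phi x = ip x z.
Proof.
move=> lphi M0 phiM; pose K := [set x | phi x = 0].
have phi00 : phi 0 = 0.
  have := lphi (-1) 0 0; rewrite scaler0 addr0 mulN1r addNr; exact.
have KS : is_subspace K by split=> // a x y Kx Ky; rewrite /K /= lphi Kx Ky mulr0 addr0.
have [K1|/existsNP[x0 x00]] := pselect (forall x, phi x = 0).
  by exists 0 => x; rewrite K1 linear0r.
have [p Kp ortho] := orthogonal_projection ipN x0 KS.
have phip : phi p = 0 := linear_form_closed lphi M0 phiM (fun y h => h) Kp.
set w := x0 - p in ortho.
have phiw : phi w = phi x0.
  by rewrite /w addrC -scaleN1r lphi phip mulr0 add0r.
have phiw0 : phi w != 0 by rewrite phiw; apply/eqP.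
have ww0 : ip w w != 0.
  apply: contraNneq phiw0 => /(congr1 (@complex.Re R)); rewrite -snorm_sqr // => /eqP.
  by rewrite sqrf_eq0 => /eqP/(snorm_eq0 ipN) ->; rewrite phi00.
exists (conjc (phi w / ip w w) *: w) => x.
have Kx : K (- (phi x / phi w) *: w + x).
  by rewrite /K /= lphi mulNr divfK // addNr.
have := ortho _ Kx; rewrite (sdot_conj sd) => /(congr1 (@conjc R)).
rewrite conjcK conjc0 (sdot_lin sd) => /eqP; rewrite mulNr addrC subr_eq0 => /eqP xw.
by rewrite sdotZr // conjcK xw mulrCA (divfK ww0) (divfK phiw0).
Qed.

(** Choosing a Riesz representative for every [y] gives a linear map because
    representatives are unique. *)
Lemma adjointP T : bounded_op T ->
  bounded_op (adjoint ip T) /\ forall x y, ip (T x) y = ip x (adjoint ip T y).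
Proof.
move=> bT; apply: (getPex (P := [set X | bounded_op X /\ _])).
have [lT _] := bT; have [M M0 MT] := bounded_opP ipN bT.
have rep y : exists z, forall x, ip (T x) y = ip x z.
  apply: (@riesz_representation _ (M * N y)) => [a x x'||x].
  - by rewrite lT (sdot_lin sd).
  - by rewrite mulr_ge0 // snorm_ge0.
  - apply: le_trans (sdot_CauchySchwarz sd _ _) _.
    by rewrite mulrAC ler_wpM2r // snorm_ge0.
have [X XP] := choice rep.
exists X; split; last by move=> x y; apply: XP.
apply: (bounded_op_intro ipN (M := M)) => [a u v|x].
  by apply: (sdot_inj ipN) => z; rewrite -XP !(sdotDr sd, sdotZr sd) !XP.
have [->|X0] := eqVneq (N (X x)) 0; first by rewrite mulr_ge0 // snorm_ge0.
have Xgt : 0 < N (X x) by rewrite lt0r X0 snorm_ge0.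
rewrite -(ler_pM2l Xgt) -expr2 snorm_sqr // -XP.
apply: le_trans (Re_sdot_le sd _ _) _.
by rewrite mulrA [N _ * M]mulrC ler_wpM2r ?snorm_ge0.
Qed.

End Operators.

(** * The uniform boundedness principle *)

Section UniformBoundedness.
Context (R : realType) (H : completeNormedModType R[i]).
Context (ip : {dot H for Num.conj}) (ipN : induces_norm ip).
Implicit Types (x y z : H) (p : H -> R).
Local Notation N := (snorm ip).
Let sd : semi_dot ip := ip_semi_dot ipN.

Record bounded_seminorm p : Prop := BoundedSeminorm {
  bseminormD : forall x y, p (x + y) <= p x + p y;
  bseminormZ : forall (t : R) x, p (t%:C *: x) = `|t| * p x;
  bseminormM : exists M : R, forall x, p x <= M * N x }.

Lemma bseminormN p x : bounded_seminorm p -> p (- x) = p x.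
Proof.
move=> bp; have := bseminormZ bp (-1) x.
by rewrite rmorphN rmorph1 scaleN1r normrN normr1 mul1r.
Qed.

(** If [p] is large at [h], it cannot be small at both [c + h] and [c - h], because
    [2 h] is their difference. Hence being large is not confined to balls centred
    at the origin. *)
Lemma large_in_ball p c (r K : R) : bounded_seminorm p -> 0 < r -> 0 <= K ->
  (exists x, K / r * N x < p x) -> exists2 y, N (y - c) <= r & K < p y.
Proof.
move=> bp r0 K0 [x px]; have [M pM] := bseminormM bp.
have Nx : 0 < N x.
  rewrite lt0r snorm_ge0 andbT; apply: contraTneq px => Nx0.
  by rewrite -leNgt; have := pM x; rewrite Nx0 !mulr0.
pose h := (r / N x)%:C *: x.
have rN0 : 0 < r / N x by rewrite divr_gt0.
have Nh : N h = r by rewrite snormZ // normcR gtr0_norm // divfK ?gt_eqF.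
have ph : K < p h.
  rewrite (bseminormZ bp) gtr0_norm //.
  have -> : K = r / N x * (K / r * N x) by field; rewrite !gt_eqF.
  by rewrite ltr_pM2l.
have : 2 * p h <= p (c + h) + p (c - h).
  rewrite -(bseminormN (c - h) bp) -[2]ger0_norm // -(bseminormZ bp).
  apply: le_trans (bseminormD bp _ _); rewrite rmorph_nat scaler_nat mulr2n.
  by rewrite opprB [c + h + _]addrC addrA subrK.
have [pch|pch] := ltP K (p (c + h)).
  by exists (c + h) => //; rewrite addrC addKr Nh.
move=> h2; exists (c - h); last by lra.
by rewrite addrAC subrr add0r snormN // Nh.
Qed.

(** The inductive step of the gliding argument: since each [p] is continuous, a value
    above [K] persists on a whole smaller ball. *)
Lemma large_on_subball (F : set (H -> R)) c (r K e : R) :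
  (forall p, F p -> bounded_seminorm p) ->
  (forall K, 0 <= K -> exists2 p, F p & exists x, K * N x < p x) ->
  0 < r -> 0 <= K -> 0 < e ->
  exists c' r', [/\ 0 < r', N (c - c') + r' <= r, r' <= e &
    exists2 p, F p & forall y, N (c' - y) <= r' -> K < p y].
Proof.
move=> Fb unb r0 K0 e0.
have r20 : 0 < r / 2 by rewrite divr_gt0.
have [p Fp px] := unb (K / (r / 2)) (divr_ge0 K0 (ltW r20)).
have bp := Fb _ Fp; have [M pM] := bseminormM bp.
have [c' cc' pc'] := large_in_ball c bp r20 K0 px.
have M0 : 0 < `|M| + 1 by rewrite ltr_wpDl.
(* A radius on which [p] moves by at most half of its excess over [K]. *)
pose g := (p c' - K) / 2 / (`|M| + 1).
have g0 : 0 < g by rewrite !divr_gt0 // subr_gt0.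
pose r' := Num.min (r / 2) (Num.min e g).
have r'r : r' <= r / 2 by rewrite ge_min lexx.
have r'e : r' <= e by rewrite !ge_min lexx orbT.
have r'g : r' <= g by rewrite !ge_min lexx !orbT.
exists c', r'; split=> //.
- by rewrite !lt_min r20 e0 g0.
- by rewrite (snormBC sd); lra.
- exists p => // y yc'.
  have h1 : p c' <= p y + p (c' - y).
    by rewrite -{1}[c'](subrK y) [_ + y]addrC (bseminormD bp).
  have h2 : p (c' - y) <= (p c' - K) / 2.
    apply: le_trans (pM _) _.
    apply: (@le_trans _ _ ((`|M| + 1) * N (c' - y))).
      by rewrite ler_wpM2r ?snorm_ge0 // (le_trans (ler_norm M)) // lerDl.
    by rewrite mulrC -ler_pdivlMr // (le_trans yc').
  lra.
Qed.

(** Otherwise [large_on_subball] produces nested balls on the [n]-th of which some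
    member of [F] exceeds [n], and [F] is unbounded at their common point. *)
Lemma uniform_boundedness (F : set (H -> R)) :
  (forall p, F p -> bounded_seminorm p) ->
  (forall x, exists M, forall p, F p -> p x <= M) ->
  exists2 K, 0 <= K & forall p, F p -> forall x, p x <= K * N x.
Proof.
move=> Fb pw; apply: contrapT => nK.
have unb K : 0 <= K -> exists2 p, F p & exists x, K * N x < p x.
  move=> K0; apply: contrapT => nF; apply: nK; exists K => // p Fp x.
  by rewrite leNgt; apply/negP => px; apply: nF; exists p => //; exists x.
pose next (n : nat) (s s' : H * R) := [/\ 0 < s'.2, N (s.1 - s'.1) + s'.2 <= s.2,
  s'.2 <= n.+1%:R^-1 &
  exists2 p, F p & forall y, N (s'.1 - y) <= s'.2 -> n%:R < p y].
(* Positivity of the radius is a premise inside the relation so that choice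
   yields a total function on pairs. *)
have hnext (ns : nat * (H * R)) :
    exists s', 0 < ns.2.2 -> next ns.1 ns.2 s'.
  case: ns => n [c r] /=.
  have [r0|_] := ltP 0 r; last by exists (0, 0).
  have [|c' [r' h]] := large_on_subball c Fb unb r0 (ler0n R n) (_ : 0 < n.+1%:R^-1).
    by rewrite invr_gt0 ltr0n.
  by exists (c', r').
have [g gP] := choice hnext.
pose s := fix s n := if n is m.+1 then g (m, s m) else (0, 1).
have sgt n : 0 < (s n).2.
  by elim: n => [|n IH] /=; [exact: ltr01 | case: (gP (n, s n) IH)].
have sP n : next n (s n) (s n.+1) := gP (n, s n) (sgt n).
have balls m n : (n <= m)%N -> N ((s n).1 - (s m).1) + (s m).2 <= (s n).2.
  move=> /subnKC <-; elim: (m - n)%N => [|k IH].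
    by rewrite addn0 subrr /snorm sdot0l // sqrtr0 add0r.
  rewrite addnS; have [_ h _ _] := sP (n + k)%N.
  have := snorm_tri sd (s (n + k)%N).1 (s n).1 (s (n + k).+1).1; lra.
have [|e e0|l lP] := @nested_balls_limit _ _ _ ipN
    (fun n => (s n.+1).1) (fun n => (s n.+1).2).
- move=> m n nm; have := balls m.+1 n.+1 nm; have := sgt m.+1; lra.
- have [n ne] := lt_inv_nat e0; exists n; apply: le_lt_trans ne.
  by have [_ _ h _] := sP n.
have [M plM] := pw l.
have [_ _ _ [p Fp pl]] := sP (Num.bound `|M|).
have := pl l (lP _); have := plM p Fp.
have := archi_boundP (normr_ge0 M); have := ler_norm M; lra.
Qed.

End UniformBoundedness.

(** * The distinguished adjoint with respect to a positive operator *)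

Section PositiveOperators.
Context (R : realType) (H : completeNormedModType R[i]).
Context (ip : {dot H for Num.conj}) (ipN : induces_norm ip).
Implicit Types (x y z : H) (T A : H -> H) (E : set H).
Local Notation N := (snorm ip).
Let sd : semi_dot ip := ip_semi_dot ipN.

(** Over the complex numbers positivity implies symmetry: the form is real at
    [x + y] and at [x + i y], which determines the imaginary and the real part of
    [<A y, x>] from those of [<A x, y>]. *)
Lemma positive_form_semi_dot A : linear A -> positive_op ip A ->
  semi_dot (fun x y => ip (A x) y).
Proof.
move=> lA pA; split=> // [a x y z|x y]; first by rewrite lA (sdot_lin sd).
have quad (c : R[i]) : complex.Im (conjc c * ip (A x) y + c * ip (A y) x) = 0.
  have := ger0_Im (pA (c *: y + x)).
  rewrite lA !(sdotDl sd, sdotDr sd, sdotZl sd, sdotZr sd).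
  have := ger0_Im (pA x); have := ger0_Im (pA y).
  case: (ip (A x) x) => ? ?; case: (ip (A y) y) => ? ?.
  case: (ip (A x) y) => ? ?; case: (ip (A y) x) => ? ?; case: c => ? ? /=.
  move=> -> ->; lra.
have := quad 1; have := quad (Complex 0 1); clear quad.
case: (ip (A x) y) => a b; case: (ip (A y) x) => c d /= h1 h2.
by congr Complex; lra.
Qed.

Lemma positive_op_symmetric A x y : linear A -> positive_op ip A ->
  ip (A x) y = ip x (A y).
Proof.
move=> lA pA; rewrite (sdot_conj (positive_form_semi_dot lA pA)).
by rewrite -(sdot_conj sd).
Qed.

Lemma range_subspace A : linear A -> is_subspace (range A).
Proof.
move=> lA; split; first by exists 0 => //; exact: linear_op0.
by move=> a _ _ [x _ <-] [y _ <-]; exists (a *: x + y); rewrite ?lA.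
Qed.

Lemma closure_subspace E : is_subspace E -> is_subspace (closure E).
Proof.
move=> [E0 El]; split=> [|a x y /(closureP ipN) Ex /(closureP ipN) Ey].
  exact: subset_closure.
apply/(closureP ipN) => e e0.
have a1 : 0 < normc a + 1 by rewrite ltr_wpDl ?normc_ge0.
have [|x' Ex' xx'] := Ex (e / 2 / (normc a + 1)); first by rewrite !divr_gt0.
have [|y' Ey' yy'] := Ey (e / 2); first by rewrite divr_gt0.
exists (a *: x' + y'); first exact: El.
rewrite opprD addrACA -scalerBr (le_lt_trans (snormD sd _ _)) // snormZ //.
have : normc a * N (x - x') <= e / 2.
  move: xx'; rewrite ltr_pdivlMr //; have := snorm_ge0 ip (x - x'); lra.
lra.
Qed.

(** The orthogonal complement of the range of the symmetric operator [A] is its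
    kernel, so projecting onto the closure of the range does not change the image
    under [A]. *)
Lemma closure_range_repr A x : linear A -> positive_op ip A ->
  exists2 p, closure (range A) p & A p = A x.
Proof.
move=> lA pA; have [p Ep ortho] := orthogonal_projection ipN x (range_subspace lA).
exists p => //; apply/esym/eqP; rewrite -subr_eq0 -linear_opB //; apply/eqP.
apply: (sdot_inj ipN) => z; rewrite -positive_op_symmetric // linear0r.
by rewrite (sdot_conj sd) ortho ?conjc0 //; exists z.
Qed.

(** A vector in the kernel of [A] is orthogonal to the range of [A], hence to its
    closure, and therefore to itself if it lies there. *)
Lemma closure_range_inj A p : linear A -> positive_op ip A ->
  closure (range A) p -> A p = 0 -> p = 0.
Proof.
move=> lA pA Ep Ap; apply: (snorm_eq0 ipN); apply/eqP.
rewrite -sqrf_eq0 snorm_sqr //.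
suff -> : ip p p = 0 by [].
apply: (@linear_form_closed _ _ _ ipN (fun x => ip x p) (N p)
  _ _ _ _ _ _ Ep) => [a x y|||_ [y _ <-]].
- exact: (sdot_lin sd).
- exact: snorm_ge0.
- by move=> x; rewrite mulrC; exact: sdot_CauchySchwarz.
- by rewrite positive_op_symmetric // Ap linear0r.
Qed.

(** Existence of the reduced solution (Douglas). Its uniqueness makes it linear, and
    its boundedness comes from testing [X y] against vectors [A z] only: these are
    dense where [X y] lives, and [<X y, A z> = <T^* A y, z>] is bounded in [y] for
    each [z]. *)
Lemma sharpP A T : bounded_op A -> positive_op ip A -> BA ip A T ->
  [/\ bounded_op (sharp ip A T), A \o sharp ip A T = adjoint ip T \o A
    & range (sharp ip A T) `<=` closure (range A)].
Proof.
move=> bA pA [bT rT]; have lA := bA.1.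
have [bT' _] := adjointP ipN bT; have lT' := bT'.1.
apply: (getPex (P := [set X | [/\ bounded_op X, _ & _]])).
have sol y : exists p, closure (range A) p /\ A p = adjoint ip T (A y).
  have [|u _ Au] := rT (adjoint ip T (A y)); first by exists y.
  by have [p Ep Ap] := closure_range_repr u lA pA; exists p; rewrite Ap Au.
have [X XP] := choice sol.
exists X; split; last by move=> _ [y _ <-]; case: (XP y).
  2: by apply/funext => y; case: (XP y).
have lX : linear X.
  move=> a x y; apply/eqP; rewrite -subr_eq0; apply/eqP.
  have [Ex Ax] := XP x; have [Ey Ay] := XP y; have [Exy Axy] := XP (a *: x + y).
  have [_ Ecl] := closure_subspace (range_subspace lA).
  apply: (closure_range_inj lA pA).
    rewrite [X (_ + _) + _]addrC -scaleN1r; exact: (Ecl _ _ _ (Ecl a _ _ Ex Ey) Exy).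
  by rewrite linear_opB // Axy !(lA, lT') Ax Ay subrr.
have [M' M'0 T'M] := bounded_opP ipN bT'; have [M M0 AM] := bounded_opP ipN bA.
(* The functionals must be normalised by [N (A z)] and not by [N z]. *)
pose F := [set (fun y => normc (ip (X y) (A z))) | z in [set z | N (A z) <= 1]].
have FB p : F p -> bounded_seminorm ip p.
  move=> [z _ <-]; split=> [x y|t x|].
  - by rewrite linear_opD // (sdotDl sd) le_normcD.
  - by rewrite linear_opZ // (sdotZl sd) Normc.normcM normcR.
  exists (M' * M * N z) => x; have [_ Ax] := XP x.
  rewrite -positive_op_symmetric // Ax.
  apply: (le_trans (sdot_CauchySchwarz sd _ _)).
  rewrite mulrAC ler_wpM2r ?snorm_ge0 // (le_trans (T'M _)) //.
  by rewrite -mulrA ler_wpM2l.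
have [|K K0 FK] := uniform_boundedness ipN FB.
  move=> x; exists (N (X x)) => _ [z /= z1 <-].
  apply: (le_trans (sdot_CauchySchwarz sd _ _)).
  by rewrite ler_piMr // snorm_ge0.
have key y z : normc (ip (X y) (A z)) <= K * N y * N (A z).
  have [z0|z0] := eqVneq (N (A z)) 0.
    by apply: (le_trans (sdot_CauchySchwarz sd _ _)); rewrite z0 !mulr0.
  have zgt : 0 < N (A z) by rewrite lt0r z0 snorm_ge0.
  pose z' := (N (A z))^-1%:C *: z.
  have Az' : A z' = (N (A z))^-1%:C *: A z by rewrite linear_opZ.
  have nV : normc (N (A z))^-1%:C = (N (A z))^-1.
    by rewrite normcR ger0_norm // invr_ge0 snorm_ge0.
  have Fz' : F (fun y => normc (ip (X y) (A z'))).
    by exists z' => //=; rewrite Az' snormZ // nV mulVf.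
  have := FK _ Fz' y; rewrite Az' (sdotZr sd) Normc.normcM conjcR nV.
  by rewrite mulrC ler_pdivrMr.
apply: (bounded_op_intro ipN (M := K) lX) => y.
have [X0|X0] := eqVneq (N (X y)) 0; first by rewrite X0 mulr_ge0 // snorm_ge0.
have Xgt : 0 < N (X y) by rewrite lt0r X0 snorm_ge0.
(* Approximating [X y] itself by [A z] turns the bound [key] on inner products into
   a bound on [N (X y) ^+ 2]. *)
rewrite -subr_le0 -(pmulr_rle0 _ Xgt).
apply: (@le0_inv_nat _ _ (N (X y) + K * N y)) => n.
have [/(closureP ipN) EX _] := XP y.
have e0 : 0 < n.+1%:R^-1 :> R by rewrite invr_gt0 ltr0n.
move: (n.+1%:R^-1 : R) e0 => e e0.
have [_ [z _ <-] Xz] := EX e e0.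
have h1 := Re_sdot_le sd (X y) (X y - A z).
have h2 : Re (ip (X y) (A z)) <= K * N y * (N (X y) + e).
  apply: le_trans (Re_le_normc _) _; apply: le_trans (key _ _) _.
  rewrite ler_wpM2l ?mulr_ge0 ?snorm_ge0 //.
  have := snorm_tri sd (X y) (A z) 0; rewrite (snormBC sd (A z) (X y)) !subr0; lra.
have h3 : N (X y) ^+ 2 = Re (ip (X y) (X y - A z)) + Re (ip (X y) (A z)).
  by rewrite -ReD -(sdotDr sd) subrK snorm_sqr.
nra.
Qed.

Lemma sharp_adjoint A T x y : bounded_op A -> positive_op ip A -> BA ip A T ->
  ip (A (T x)) y = ip (A x) (sharp ip A T y).
Proof.
move=> bA pA BT; have [_ AX _] := sharpP bA pA BT.
have lA := bA.1; have [_ adj] := adjointP ipN BT.1.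
rewrite (positive_op_symmetric (T x)) // adj (positive_op_symmetric x) //.
by congr (ip _ _); rewrite -[LHS]/((adjoint ip T \o A) y) -AX.
Qed.

End PositiveOperators.

(** * Real inequalities *)

Section PowerGrowth.
Context {R : realType}.
Implicit Types (q b D : R).

Lemma bernoulli_le (d : R) m : 0 <= d -> 1 + m%:R * d <= (1 + d) ^+ m.
Proof.
move=> d0; elim: m => [|m IH]; first by rewrite mul0r addr0.
rewrite exprS -natr1.
have d1 : 0 <= 1 + d by rewrite addr_ge0.
apply: le_trans (ler_wpM2l d1 IH).
have : 0 <= m%:R * (d * d) by rewrite !mulr_ge0.
nra.
Qed.

(** If [b < q] then [(q / b) ^ (2 ^ n)] is unbounded by Bernoulli's inequality. *)
Lemma le_of_pow2_le q b D : 0 <= b ->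
  (forall n, q ^+ (2 ^ n) <= D * b ^+ (2 ^ n)) -> q <= b.
Proof.
move=> b0 h; rewrite leNgt; apply/negP => bq.
have [bz|bn0] := eqVneq b 0.
  by have := h 0%N; rewrite expn0 !expr1 bz mulr0 leNgt -bz bq.
have bgt : 0 < b by rewrite lt0r bn0.
pose d := q / b - 1.
have d0 : 0 < d by rewrite subr_gt0 ltr_pdivlMr // mul1r.
have hD n : n%:R * d <= D.
  have := bernoulli_le (2 ^ n) (ltW d0).
  rewrite /d subrKC expr_div_n -/d => h1.
  have h2 : q ^+ (2 ^ n) / b ^+ (2 ^ n) <= D by rewrite ler_pdivrMr ?exprn_gt0.
  have h3 : n%:R * d <= (2 ^ n)%:R * d.
    by rewrite ler_wpM2r ?(ltW d0) // ler_nat ltnW // ltn_expl.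
  lra.
have := archi_boundP (normr_ge0 (D / d)); rewrite ltNge => /negP; apply.
apply: le_trans (ler_norm _); rewrite ler_pdivlMr //; exact: hD.
Qed.

End PowerGrowth.

Lemma sqr_le_le (R : realType) (x y : R) : 0 <= y -> x ^+ 2 <= y ^+ 2 -> x <= y.
Proof.
move=> y0; rewrite -[x ^+ 2]real_normK ?num_real // ler_sqr ?nnegrE //.
exact: le_trans (ler_norm _).
Qed.

(** The largest eigenvalue of the symmetric matrix with diagonal entries [p], [q] and
    off-diagonal entry [c]. *)
Definition top_eigenvalue (R : realType) (p q c : R) : R :=
  2^-1 * (p + q + Num.sqrt ((p - q) ^+ 2 + 4 * c ^+ 2)).

(** In terms of [s^2 + t^2], [s^2 - t^2] and [2 s t], this is Cauchy-Schwarz in the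
    plane for the vectors [(p - q, 2 c)] and [(s^2 - t^2, 2 s t)], the latter of
    norm [s^2 + t^2]. *)
Lemma top_eigenvalue_max (R : realType) (p q c s t : R) :
  p * s ^+ 2 + q * t ^+ 2 + 2 * c * (s * t)
    <= top_eigenvalue p q c * (s ^+ 2 + t ^+ 2).
Proof.
rewrite /top_eigenvalue; set r := Num.sqrt _.
have r0 : 0 <= r by exact: sqrtr_ge0.
have rr : r ^+ 2 = (p - q) ^+ 2 + 4 * c ^+ 2.
  by rewrite sqr_sqrtr // addr_ge0 ?sqr_ge0 // mulr_ge0 // sqr_ge0.
have : (p - q) * (s ^+ 2 - t ^+ 2) + 4 * c * (s * t) <= r * (s ^+ 2 + t ^+ 2).
  apply: sqr_le_le; first by rewrite mulr_ge0 // addr_ge0 // sqr_ge0.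
  rewrite [leRHS]exprMn rr.
  have := sqr_ge0 ((p - q) * (2 * s * t) - 2 * c * (s ^+ 2 - t ^+ 2)); lra.
lra.
Qed.

Lemma top_eigenvalue_ge0 (R : realType) (p q c : R) : 0 <= p -> 0 <= q ->
  0 <= top_eigenvalue p q c.
Proof. by move=> p0 q0; rewrite mulr_ge0 // !addr_ge0 // sqrtr_ge0. Qed.

Lemma top_eigenvalue_le (R : realType) (p q c : R) : 0 <= p -> 0 <= q ->
  c ^+ 2 <= p * q -> top_eigenvalue p q c <= p + q.
Proof.
move=> p0 q0 cpq; rewrite /top_eigenvalue.
have : Num.sqrt ((p - q) ^+ 2 + 4 * c ^+ 2) <= p + q.
  have pq0 : 0 <= p + q by rewrite addr_ge0.
  rewrite -[leRHS](ger0_norm pq0) -sqrtr_sqr ler_sqrt; last exact: sqr_ge0.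
  lra.
lra.
Qed.

(** * Adjoint pairs for a semi-definite form *)

Section AdjointPairs.
Context (R : realType) (V : lmodType R[i]).
Context (f : V -> V -> R[i]) (sd : semi_dot f).
Implicit Types (T S B : V -> V).
Local Notation N := (snorm f).

(** Cauchy-Schwarz gives
    [|B^k x|^2 = <x, B^(2k) x> <= |x| |B^(2k) x|]; repeated doubling of [k] bounds
    [|B x|^(2^n)] by [|x|^(2^n - 1) |B^(2^n) x|], and the
    constant [D] disappears as [n] grows. *)
Lemma selfadjoint_snorm_le B (b : R) : 0 <= b ->
  (forall x y, f (B x) y = f x (B y)) ->
  (forall x, exists D, forall k, N (iter k B x) <= D * b ^+ k) ->
  forall x, N (B x) <= b * N x.
Proof.
move=> b0 sB Bk x; have [D DP] := Bk x; pose a k := N (iter k B x).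
have a0 k : 0 <= a k by exact: snorm_ge0.
have siter k y z : f (iter k B y) z = f y (iter k B z).
  by elim: k y z => // k IH y z; rewrite iterS sB IH -iterSr.
have sqa k : a k ^+ 2 <= a 0%N * a (k + k)%N.
  rewrite /a snorm_sqr // siter -iterD; exact: Re_sdot_le.
have [z|nz] := eqVneq (a 0%N) 0.
  have := sqa 1%N; rewrite z mul0r => h.
  have : a 1%N ^+ 2 == 0 by rewrite eq_le h sqr_ge0.
  rewrite sqrf_eq0 => /eqP a1; rewrite -[N (B x)]/(a 1%N) a1.
  by rewrite -[N x]/(a 0%N) z mulr0.
have gt0 : 0 < a 0%N by rewrite lt0r nz a0.
(* Multiplying by [a 0] on the left avoids the exponent [2 ^ n - 1]. *)
have grow n : a 1%N ^+ (2 ^ n) * a 0%N <= a 0%N ^+ (2 ^ n) * a (2 ^ n)%N.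
  elim: n => [|n IH]; first by rewrite expn0 !expr1 mulrC.
  rewrite expnSr !exprM muln2 -addnn -(ler_pM2r gt0).
  set u := a 1%N ^+ _ in IH *; set v := a 0%N ^+ _ in IH *.
  have u0 : 0 <= u by rewrite exprn_ge0.
  have v0 : 0 <= v by rewrite exprn_ge0.
  apply: (@le_trans _ _ ((u * a 0%N) ^+ 2)); first by rewrite exprMn expr2 mulrA.
  apply: (@le_trans _ _ ((v * a (2 ^ n)%N) ^+ 2)).
    by rewrite ler_sqr ?nnegrE ?mulr_ge0.
  by rewrite exprMn -[leRHS]mulrA ler_wpM2l ?sqr_ge0 // mulrC.
rewrite -[N (B x)]/(a 1%N) -[N x]/(a 0%N).
apply: (@le_of_pow2_le _ _ _ (D / a 0%N)); first exact: mulr_ge0.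
move=> n; rewrite mulrAC ler_pdivlMr // exprMn.
apply: (le_trans (grow n)).
rewrite mulrA [leRHS]mulrC ler_wpM2l ?exprn_ge0 //; exact: DP.
Qed.

(** This is Cauchy-Schwarz in [|T' x|^2 = <T T' x, x>]. *)
Lemma adjoint_snorm_le T T' (a : R) :
  (forall x y, f (T x) y = f x (T' y)) ->
  (forall x, N (T x) <= a * N x) -> forall x, N (T' x) <= a * N x.
Proof.
move=> adj Ta x.
have [z|nz] := eqVneq (N (T' x)) 0.
  by rewrite z; apply: le_trans (Ta x); exact: snorm_ge0.
have gt0 : 0 < N (T' x) by rewrite lt0r nz snorm_ge0.
rewrite -(ler_pM2l gt0) -expr2 snorm_sqr // -adj.
apply: (le_trans (Re_sdot_le sd _ _)).
by rewrite mulrA [N _ * a]mulrC ler_wpM2r ?snorm_ge0.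
Qed.

(** The column operator [(T, S)] and its adjoint have equal norms, and the latter is
    controlled by the two-by-two matrix of norms of the products [T T'], [T S'] and
    [S S'], whose largest eigenvalue is the bound. *)
Lemma sum_sqr_snorm_le T T' S S' (a b c : R) :
  (forall x y, f (T x) y = f x (T' y)) -> (forall x y, f (S x) y = f x (S' y)) ->
  0 <= a -> 0 <= b ->
  (forall x, N (T x) <= a * N x) -> (forall x, N (S x) <= b * N x) ->
  (forall x, N (T (S' x)) <= c * N x) ->
  forall x, N (T x) ^+ 2 + N (S x) ^+ 2
    <= top_eigenvalue (a ^+ 2) (b ^+ 2) c * N x ^+ 2.
Proof.
move=> adT adS a0 b0 Ta Sb TSc x.
set u := T x; set v := S x; set q := _ + _; set lam := top_eigenvalue _ _ _.
have q0 : 0 <= q by rewrite addr_ge0 ?sqr_ge0.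
have lam0 : 0 <= lam by apply: top_eigenvalue_ge0; exact: sqr_ge0.
(* This is the value at [x] of [T' T + S' S]. *)
pose y := T' u + S' v.
have qy : q <= N x * N y.
  have -> : q = Re (f x y).
    by rewrite sdotDr // ReD -adT -adS -/u -/v /q !snorm_sqr.
  exact: Re_sdot_le.
have yq : N y ^+ 2 <= lam * q.
  apply: le_trans (top_eigenvalue_max (a ^+ 2) (b ^+ 2) c (N u) (N v)).
  rewrite snormD_sqr // (Re_sdotC sd (T' u)) -adT (Re_sdotC sd _ u).
  have h1 := adjoint_snorm_le adT Ta u; have h2 := adjoint_snorm_le adS Sb v.
  have h3 : Re (f u (T (S' v))) <= N u * (c * N v).
    by apply: le_trans (Re_sdot_le sd _ _) _; rewrite ler_wpM2l ?snorm_ge0.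
  have h1' : N (T' u) ^+ 2 <= (a * N u) ^+ 2.
    by rewrite ler_sqr ?nnegrE ?mulr_ge0 ?snorm_ge0.
  have h2' : N (S' v) ^+ 2 <= (b * N v) ^+ 2.
    by rewrite ler_sqr ?nnegrE ?mulr_ge0 ?snorm_ge0.
  lra.
have [->|qn0] := eqVneq q 0; first by rewrite mulr_ge0 // sqr_ge0.
have qgt : 0 < q by rewrite lt0r qn0.
rewrite -(ler_pM2r qgt) mulrAC.
apply: (@le_trans _ _ (N x ^+ 2 * N y ^+ 2)).
  by rewrite -exprMn -expr2 ler_sqr ?nnegrE // mulr_ge0 // snorm_ge0.
by rewrite mulrC ler_wpM2r ?sqr_ge0.
Qed.

End AdjointPairs.

(** * The seminorm, operator seminorm and numerical radius of a positive operator *)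

Lemma sup_le_ge0 (R : realType) (D : set R) (M : R) : 0 <= M ->
  ubound D M -> sup D <= M.
Proof.
move=> M0 DM; have [->|D0] := eqVneq D set0; first by rewrite sup0.
by apply: ge_sup => //; apply/set0P.
Qed.

Lemma sup_ge0_ubound (R : realType) (D : set R) (M : R) :
  (forall d, D d -> 0 <= d) -> ubound D M -> 0 <= sup D.
Proof.
move=> Dge0 DM; have [->|/set0P[d Dd]] := eqVneq D set0; first by rewrite sup0.
by apply: (le_trans (Dge0 d Dd)); apply: ub_le_sup => //; exists M.
Qed.

Section ASeminorm.
Context (R : realType) (H : completeNormedModType R[i]).
Context (ip : {dot H for Num.conj}) (ipN : induces_norm ip).
Context (A : H -> H) (bA : bounded_op A) (pA : positive_op ip A).
Implicit Types (x y z : H) (T S X : H -> H).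
Local Notation N := (snorm ip).
Local Notation f := (fun x y => ip (A x) y).
Local Notation nA := (snorm f).
Let sd : semi_dot ip := ip_semi_dot ipN.
Let lA : linear A := bA.1.
Let sA : semi_dot f := positive_form_semi_dot ipN lA pA.

Definition A_bounded X (C : R) := 0 <= C /\ forall x, nA (X x) <= C * nA x.

Lemma snormA_le : exists2 c : R, 0 <= c & forall x, nA x <= c * N x.
Proof.
have [M M0 AM] := bounded_opP ipN bA.
have M1 : 0 <= M + 1 by rewrite addr_ge0.
exists (M + 1) => // x; apply: sqr_le_le; first by rewrite mulr_ge0 // snorm_ge0.
rewrite (snorm_sqr sA); apply: (le_trans (Re_sdot_le sd _ _)).
have := AM x; have := snorm_ge0 ip x; have := sqr_ge0 (N x); nra.
Qed.

(** The operator [B = T# T] is symmetric for the form and bounded for the norm of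
    [H], hence bounded for the seminorm by [selfadjoint_snorm_le]; and
    [|T x|_A^2 = <x, B x>_A]. *)
Lemma BA_A_bounded T : BA ip A T -> exists C, A_bounded T C.
Proof.
move=> BT; have [bX _ _] := sharpP ipN bA pA BT.
have adj x y := sharp_adjoint ipN x y bA pA BT.
set X := sharp ip A T in bX adj.
have [t t0 Tt] := bounded_opP ipN BT.1; have [s s0 Xs] := bounded_opP ipN bX.
have [c c0 cN] := snormA_le.
pose B := X \o T; pose b := s * t.
have b0 : 0 <= b by rewrite mulr_ge0.
have BN x : N (B x) <= b * N x.
  by apply: (le_trans (Xs _)); rewrite /b -mulrA ler_wpM2l.
have BNk k x : N (iter k B x) <= b ^+ k * N x.
  elim: k => [|k IH]; first by rewrite expr0 mul1r.
  by rewrite iterS exprS -mulrA (le_trans (BN _)) // ler_wpM2l.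
have Bb x : nA (B x) <= b * nA x.
  apply: (selfadjoint_snorm_le sA b0) => {x} [x y|x].
    by rewrite (sdot_conj sA) /= -adj (sdot_conj sA) /= -adj -!(sdot_conj sA).
  exists (c * N x) => k; apply: (le_trans (cN _)).
  by rewrite -mulrA ler_wpM2l // mulrC.
(* [b] is at most the square of [b + 1]. *)
exists (b + 1); split=> [|x]; first by rewrite addr_ge0.
apply: sqr_le_le; first by rewrite mulr_ge0 ?snorm_ge0 // addr_ge0.
rewrite (snorm_sqr sA) /= adj; apply: (le_trans (Re_sdot_le sA _ _)).
have := Bb x; rewrite /B /=.
have := snorm_ge0 f x; have := sqr_ge0 (nA x); nra.
Qed.

Lemma nA_eq0 x : A x = 0 -> nA x = 0.
Proof. by move=> Ax; rewrite /snorm Ax linear0l sqrtr0. Qed.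

Lemma opnormA_ubound X C : A_bounded X C ->
  ubound [set seminormA ip A (X x) | x in
         [set x | closure (range A) x /\ seminormA ip A x = 1]] C.
Proof.
move=> [_ XC] _ [x [_ x1] <-].
by have := XC x; rewrite -[nA x]/(seminormA ip A x) x1 mulr1.
Qed.

Lemma opnormA_ge0 X C : A_bounded X C -> 0 <= opnormA ip A X.
Proof.
move=> XC; apply: sup_ge0_ubound (opnormA_ubound XC) => _ [x _ <-].
exact: sqrtr_ge0.
Qed.

Lemma opnormA_le X C : A_bounded X C -> opnormA ip A X <= C.
Proof. by move=> XC; apply: sup_le_ge0 (opnormA_ubound XC); case: XC. Qed.

(** The supremum ranges over the closure of the range of [A], but an arbitrary vector
    differs from one of that closure by an element of the kernel of [A], on which
    both [nA] and [nA \o X] vanish. *)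
Lemma opnormA_A_bounded X C : linear X -> A_bounded X C ->
  A_bounded X (opnormA ip A X).
Proof.
move=> lX XC; have n0 := opnormA_ge0 XC; split=> // x.
have [p Ep Apx] := closure_range_repr ipN x lA pA.
have ker y z : A y = A z -> nA (X y) <= nA (X z).
  move=> yz; have d0 : nA (y - z) = 0 by apply: nA_eq0; rewrite linear_opB // yz subrr.
  rewrite -[y](subrK z) linear_opD //; apply: (le_trans (snormD sA _ _)).
  by have := XC.2 (y - z); rewrite d0 mulr0; lra.
have ker1 y z : A y = A z -> nA y <= nA z.
  move=> yz; have d0 : nA (y - z) = 0 by apply: nA_eq0; rewrite linear_opB // yz subrr.
  by rewrite -{1}[y](subrK z); apply: (le_trans (snormD sA _ _)); rewrite d0 add0r.
apply: (le_trans (ker _ _ (esym Apx))).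
apply: (@le_trans _ _ (opnormA ip A X * nA p)); last by rewrite ler_wpM2l // ker1.
have [p0|pn0] := eqVneq (nA p) 0.
  by have := XC.2 p; rewrite p0 !mulr0.
have pgt : 0 < nA p by rewrite lt0r pn0 snorm_ge0.
pose w := (nA p)^-1%:C *: p.
have nV : normc (nA p)^-1%:C = (nA p)^-1.
  by rewrite normcR ger0_norm // invr_ge0 snorm_ge0.
have : nA (X w) <= opnormA ip A X.
  apply: ub_le_sup; first by exists C; exact: opnormA_ubound.
  exists w => //; split; last by rewrite -[LHS]/(nA w) (snormZ sA) nV mulVf.
  have [E0 El] := closure_subspace ipN (range_subspace lA).
  by rewrite -[w]addr0; apply: El.
by rewrite linear_opZ // (snormZ sA) nV mulrC ler_pdivrMr.
Qed.

Lemma numradA_ubound X C :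
  (forall x, nA x = 1 -> normc (f (X x) x) <= C) ->
  ubound [set complex.Re `|ip (A (X x)) x| | x in
    [set x | seminormA ip A x = 1]] C.
Proof. by move=> XC _ [x x1 <-]; exact: XC. Qed.

Lemma le_numradA X C x :
  (forall x, nA x = 1 -> normc (f (X x) x) <= C) -> nA x = 1 ->
  normc (f (X x) x) <= numradA ip A X.
Proof.
move=> XC x1; apply: ub_le_sup; last by exists x.
by exists C; exact: numradA_ubound.
Qed.

Lemma numradA_ge0 X C :
  (forall x, nA x = 1 -> normc (f (X x) x) <= C) -> 0 <= numradA ip A X.
Proof.
move=> XC; apply: sup_ge0_ubound (numradA_ubound XC) => _ [x _ <-].
exact: normc_ge0.
Qed.

Lemma numradA_le X C : 0 <= C ->
  (forall x, nA x = 1 -> normc (f (X x) x) <= C) -> numradA ip A X <= C.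
Proof. by move=> C0 XC; apply: sup_le_ge0 => //; exact: numradA_ubound. Qed.

End ASeminorm.

Theorem theorem2p6 (R : realType) (H : completeNormedModType R[i])
    (ip : {dot H for Num.conj}) (A T S : H -> H) :
  induces_norm ip ->
  bounded_op A -> positive_op ip A -> A <> cst 0 ->
  BA ip A T -> BA ip A S ->
  let nT := opnormA ip A T in
  let nS := opnormA ip A S in
  let nTS := opnormA ip A (T \o sharp ip A S) in
  let w := numradA ip A (sharp ip A S \o T) in
  let m := Num.sqrt (2^-1 * (nT ^+ 2 + nS ^+ 2
             + Num.sqrt ((nT ^+ 2 - nS ^+ 2) ^+ 2 + 4 * nTS ^+ 2)) + 2 * w) in
  opnormA ip A (T \+ S) <= m /\ m <= nT + nS.
Proof.
move=> ipN bA pA _ BT BS nT nS nTS w m.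
have sA := positive_form_semi_dot ipN bA.1 pA.
set f := fun x y => ip (A x) y in sA.
have adT x y : f (T x) y = f x (sharp ip A T y) := sharp_adjoint ipN x y bA pA BT.
have adS x y : f (S x) y = f x (sharp ip A S y) := sharp_adjoint ipN x y bA pA BS.
have [bS' _ _] := sharpP ipN bA pA BS.
set T' := sharp ip A T in adT; set S' := sharp ip A S in adS bS' nTS w m *.
have lT : linear T := BT.1.1; have lS : linear S := BS.1.1.
have lS' : linear S' := bS'.1.
have [CT bT] := BA_A_bounded ipN bA pA BT; have [CS bS] := BA_A_bounded ipN bA pA BS.
have [nT0 TnT] : A_bounded ip A T nT := opnormA_A_bounded ipN bA pA lT bT.
have [nS0 SnS] : A_bounded ip A S nS := opnormA_A_bounded ipN bA pA lS bS.
have S'nS := adjoint_snorm_le sA adS SnS.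
have lTS' : linear (T \o S') by move=> a x y /=; rewrite lS' lT.
have bTS' : A_bounded ip A (T \o S') (nT * nS).
  split=> [|x /=]; first exact: mulr_ge0.
  by rewrite (le_trans (TnT _)) // -mulrA ler_wpM2l //; exact: S'nS.
have [nTS0 TS'n] : A_bounded ip A (T \o S') nTS := opnormA_A_bounded ipN bA pA lTS' bTS'.
have nTS_le : nTS <= nT * nS := opnormA_le bTS'.
have wC x : snorm f x = 1 -> normc (f ((S' \o T) x) x) <= nT * nS.
  move=> x1; rewrite normc_sdotC //= -adS (le_trans (sdot_CauchySchwarz sA _ _)) //.
  have := TnT x; have := SnS x; rewrite x1 !mulr1 => h1 h2.
  by rewrite mulrC ler_pM ?snorm_ge0.
have w_le : w <= nT * nS by apply: numradA_le => //; exact: mulr_ge0.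
have w0 : 0 <= w := numradA_ge0 wC.
(* The first summand of the statement is [top_eigenvalue] written out. *)
rewrite /m -/(top_eigenvalue (nT ^+ 2) (nS ^+ 2) nTS).
set lam := top_eigenvalue _ _ _.
have lam0 : 0 <= lam by apply: top_eigenvalue_ge0; exact: sqr_ge0.
have m0 : 0 <= lam + 2 * w by rewrite addr_ge0 // mulr_ge0.
split.
  apply: sup_le_ge0; first exact: sqrtr_ge0.
  move=> _ [x [_ x1] <-]; change (snorm f x = 1) in x1.
  change (snorm f (T x + S x) <= Num.sqrt (lam + 2 * w)).
  apply: sqr_le_le; first exact: sqrtr_ge0.
  rewrite [leRHS]sqr_sqrtr // (snormD_sqr sA).
  have := sum_sqr_snorm_le sA adT adS nT0 nS0 TnT SnS TS'n x.
  rewrite -/lam x1 expr1n mulr1.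
  have : Re (f (T x) (S x)) <= w.
    rewrite (Re_sdotC sA) adS (Re_sdotC sA).
    exact: le_trans (Re_le_normc _) (le_numradA wC x1).
  lra.
rewrite -[leRHS]ger0_norm ?addr_ge0 // -sqrtr_sqr ler_sqrt ?sqr_ge0 //.
have : lam <= nT ^+ 2 + nS ^+ 2.
  apply: top_eigenvalue_le; rewrite ?sqr_ge0 // -exprMn ler_sqr ?nnegrE //.
  exact: mulr_ge0.
lra.
Qed.
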